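(* Let $n\ge 1$, $G=GL_n(\mathbb{C})$, $\mathfrak{g}=\mathfrak{gl}_n(\mathbb{C})$, let $B\subseteq G$ be the subgroup of upper triangular matrices, and let $N=\sum_{i=1}^{n-1}E_{i,i+1}\in\mathfrak{g}$. Let $H_{\mathrm{Pet}}$ be the Hessenberg space with Hessenberg function $h(i)=i+1$ for $i<n$ and $h(n)=n$. Order the Hessenberg varieties $Hess(N,H)$, $H$ a Hessenberg space in $\mathfrak{g}$, by containment. Then every indecomposable regular nilpotent Hessenberg variety $Hess(N,H)$ lies in the closed interval of this poset whose bottom element is the Peterson variety $Hess(N,H_{\mathrm{Pet}})$ and whose top element is the full flag variety $Hess(N,\mathfrak{g})=G/B$; that is, if $Hess(N,H)$ is not decomposable, then $Hess(N,H_{\mathrm{Pet}})\subseteq Hess(N,H)\subseteq G/B$.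
   Context: A (generalized) Hessenberg space in $\mathfrak{gl}_m(\mathbb{C})$ is a subspace determined by a non-decreasing function $h:\{1,\dots,m\}\to\{0,1,\dots,m\}$ (its Hessenberg function) as $H=\mathrm{span}\{E_{j,i} : 1\le j\le h(i),\ 1\le i\le m\}$, where $E_{j,i}$ is the matrix unit with a $1$ in row $j$, column $i$. For $X\in\mathfrak{gl}_m(\mathbb{C})$ and a Hessenberg space $H\subseteq\mathfrak{gl}_m(\mathbb{C})$, with $B_m$ the upper triangular matrices in $GL_m(\mathbb{C})$, the Hessenberg variety is $Hess(X,H)=\{gB_m\in GL_m(\mathbb{C})/B_m : g^{-1}Xg\in H\}$. A Hessenberg variety $Hess(X,H)\subseteq GL_n(\mathbb{C})/B$ is decomposable if there are strictly smaller Lie algebras $\mathfrak{g}_1=\mathfrak{gl}_{n_1}(\mathbb{C})$ and $\mathfrak{g}_2=\mathfrak{gl}_{n_2}(\mathbb{C})$ with $1\le n_1,n_2<n$, elements $X_1\in\mathfrak{g}_1$, $X_2\in\mathfrak{g}_2$, and Hessenberg spaces $H_1\subseteq\mathfrak{g}_1$, $H_2\subseteq\mathfrak{g}_2$ such that $Hess(X,H)$ is homeomorphic to $Hess(X_1,H_1)\times Hess(X_2,H_2)$ (a factor is allowed to be a single point). It is indecomposable otherwise. *)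

(* Defs.v *)
From HB Require Import structures.
From mathcomp Require Import all_boot all_order all_algebra.
From mathcomp Require Import complex.
From mathcomp Require Import all_classical all_reals all_analysis.

Set Implicit Arguments.
Unset Strict Implicit.
Unset Printing Implicit Defensive.

Import GRing.Theory Num.Theory.
Import numFieldNormedType.Exports.

Local Open Scope classical_set_scope.
Local Open Scope ring_scope.
Local Open Scope quotient_scope.

(* Everything is stated over a numFieldType K with the topology of its norm and
   is used with K = R[i], the complex numbers over R : realType.  Rows and
   columns are numbered from 0. *)

Definition homeomorphic (T U : topologicalType) : Prop :=
  exists (f : T -> U) (g : U -> T),
    [/\ cancel f g, cancel g f, continuous f & continuous g].

Section FlagVariety.
Context (K : numFieldType) (n : nat).

(* As a set_type, GL carries the topology induced from 'M[K]_n. *)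
Definition GL : Type := set_type [set g : 'M[K]_n | g \in unitmx].

Definition gl_mx (g : GL) : 'M[K]_n := set_val g.

(* is_trig_mx means lower triangular, hence the transpose. *)
Definition borel : set 'M[K]_n := [set b | b \in unitmx /\ is_trig_mx b^T].

Definition borel_coset (g : GL) : set 'M[K]_n :=
  [set gl_mx g *m b | b in borel].

Definition same_coset : rel GL :=
  fun g g' => `[< borel_coset g = borel_coset g' >].

Lemma same_coset_equiv : equiv_class_of same_coset.
Proof.
split=> [g|g g'|g' g g''].
- exact/asboolP.
- by apply/asboolP/asboolP => ->.
- by move=> /asboolP gg' /asboolP g'g''; apply/asboolP; rewrite gg'.
Qed.

Canonical same_coset_equivRel := EquivRelPack same_coset_equiv.

(* GL_n(K) / B with the quotient topology. *)
Definition flag : Type := quotient_topology {eq_quot same_coset}.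

Definition flag_of (g : GL) : flag := \pi_flag g.

End FlagVariety.

Section Hessenberg.
Context (K : numFieldType).

(* h i stands for the value of the Hessenberg function at i + 1, so that row
   index j + 1 is at most this value iff j < h i. *)
Definition hessenberg_fun n (h : 'I_n -> nat) : Prop :=
  (forall i, (h i <= n)%N) /\ (forall i j : 'I_n, (i <= j)%N -> (h i <= h j)%N).

Definition hessenberg_span n (h : 'I_n -> nat) : {vspace 'M[K]_n} :=
  <<[seq delta_mx p.1 p.2 |
      p in [pred p : 'I_n * 'I_n | (p.1 < h p.2)%N]]>>%VS.

Definition hessenberg_space n (H : {vspace 'M[K]_n}) : Prop :=
  exists2 h, hessenberg_fun h & H = hessenberg_span h.

Definition hess n (X : 'M[K]_n) (H : {vspace 'M[K]_n}) : set (flag K n) :=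
  [set flag_of g | g in
    [set g : GL K n | invmx (gl_mx g) *m X *m gl_mx g \in H]].

Definition decomposable n (V : set (flag K n)) : Prop :=
  exists n1 n2 (X1 : 'M[K]_n1) (X2 : 'M[K]_n2)
         (H1 : {vspace 'M[K]_n1}) (H2 : {vspace 'M[K]_n2}),
    [/\ (1 <= n1 < n)%N, (1 <= n2 < n)%N,
        hessenberg_space H1, hessenberg_space H2 &
        homeomorphic (set_type V)
                     (set_type (hess X1 H1) * set_type (hess X2 H2))%type].

Definition regular_nilpotent n : 'M[K]_n :=
  \sum_(i < n) \sum_(j < n | j == i.+1 :> nat) delta_mx i j.

Definition peterson_fun n (i : 'I_n) : nat :=
  if (i.+1 < n)%N then i.+2 else n.

Definition peterson_space n : {vspace 'M[K]_n} :=
  hessenberg_span (@peterson_fun n).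

End Hessenberg.

Arguments regular_nilpotent {K} n.
Arguments peterson_space {K} n.

(* Main.v *)
(* For n >= 2 a Hessenberg function fails to dominate the Peterson one exactly
   when h(i) <= i for some i < n.  A flag V in Hess(N, H) then has V_i stable
   under N, and since N is regular nilpotent this forces V_i = ker N^i, the span
   of the first i basis vectors.  Such a flag amounts to a flag of V_i together
   with a flag of the quotient, and the Hessenberg condition splits accordingly
   unless h(i+1) < i; in that case N would have rank at most n - 2, so
   Hess(N, H) is empty, hence decomposable as a product of two empty varieties.
   The splitting is a homeomorphism because the projection from GL_n onto the
   flag variety is open. *)
Require Import Defs.
From HB Require Import structures.
From mathcomp Require Import all_boot all_order all_algebra.
From mathcomp Require Import complex.
From mathcomp Require Import all_classical all_reals all_analysis.

Set Implicit Arguments.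
Unset Strict Implicit.
Unset Printing Implicit Defensive.

Import GRing.Theory Num.Theory.
Import numFieldNormedType.Exports.

Local Open Scope classical_set_scope.
Local Open Scope ring_scope.
Local Open Scope complex_scope.

(** * Upper triangular matrices under products and inverses *)

Section UpperTriangular.
Context (K : fieldType).

Lemma upper_mulmx n (A B : 'M[K]_n) :
  is_trig_mx A^T -> is_trig_mx B^T -> is_trig_mx (A *m B)^T.
Proof.
move=> /is_trig_mxP tA /is_trig_mxP tB; apply/is_trig_mxP => j i lt_ji.
rewrite !mxE big1 // => k _; case: (ltnP k i) => [lt_ki|le_ik].
  by have := tA k i lt_ki; rewrite mxE => ->; rewrite mul0r.
by have := tB j k (leq_trans lt_ji le_ik); rewrite mxE => ->; rewrite mulr0.
Qed.

(** Strong induction on the column [j]: in the entry [(i, j)] of [A^-1 A = 1] with [j < i], the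
    earlier columns and the shape of [A] leave only [(A^-1) i j * A j j = 0]. *)
Lemma upper_invmx n (A : 'M[K]_n) :
  A \in unitmx -> is_trig_mx A^T -> is_trig_mx (invmx A)^T.
Proof.
move=> uA tA.
have diagA i : A i i != 0.
  move: uA; rewrite unitmxE -det_tr det_trig // unitfE => /prodf_neq0 /(_ i).
  by rewrite mxE; apply.
move/is_trig_mxP: tA => tA; apply/is_trig_mxP => j.
have [m le_jm] := ubnP (j : nat); elim: m j le_jm => // m IH j le_jm i lt_ji.
rewrite mxE; have /matrixP/(_ i j) := mulVmx uA.
rewrite !mxE (bigD1 j) //= -val_eqE gtn_eqF //= big1 => [|k ne_kj].
  by move/eqP; rewrite addr0 mulf_eq0 (negPf (diagA j)) orbF => /eqP.
have [lt_kj|le_jk] := ltnP k j.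
  have := IH k (leq_trans lt_kj le_jm) i (ltn_trans lt_kj lt_ji).
  by rewrite mxE => ->; rewrite mul0r.
have := tA j k; rewrite mxE => ->; first by rewrite mulr0.
by rewrite ltn_neqAle le_jk andbT eq_sym.
Qed.

End UpperTriangular.

(** * Hessenberg spaces as staircase patterns of zeros *)

Lemma hessenberg_spanP (K : numFieldType) n (h : 'I_n -> nat) (M : 'M[K]_n) :
  M \in hessenberg_span K h <-> forall i j : 'I_n, (h j <= i)%N -> M i j = 0.
Proof.
split=> [/coord_span -> i j le_ji|M0]; last first.
  rewrite [M]matrix_sum_delta; apply: rpred_sum => i _; apply: rpred_sum => j _.
  have [lt_ij|/M0 ->] := ltnP i (h j); last by rewrite scale0r rpred0.
  apply/rpredZ/memv_span.
  by apply: (fintype.image_f (fun p => delta_mx p.1 p.2) (x := (i, j))); rewrite inE.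
rewrite summxE big1 // => k _; rewrite mxE.
have lt_k : (k < size [seq (delta_mx p.1 p.2 : 'M[K]_n) |
    p in [pred p : 'I_n * 'I_n | (p.1 < h p.2)%N]])%N by rewrite size_image.
have /fintype.imageP[p /= lt_p ->] := mem_nth 0 lt_k.
rewrite mxE; case: eqP => [ip|]; last by rewrite mulr0.
case: eqP => [jp|]; last by rewrite mulr0.
by move: lt_p; rewrite inE -ip -jp ltnNge le_ji.
Qed.

(** Only entries [M l k] with [i <= l] and [k <= j] reach the entry [(i, j)] of the conjugate, and
    monotonicity of [h] makes them vanish when [h j <= i]. Hence the Hessenberg condition on [g]
    depends only on the coset [gB]. *)
Lemma hessenberg_span_conj (K : numFieldType) n (h : 'I_n -> nat)
    (M b : 'M[K]_n) :
  hessenberg_fun h -> borel b ->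
  M \in hessenberg_span K h -> invmx b *m M *m b \in hessenberg_span K h.
Proof.
move=> [_ h_mono] [ub tb] /hessenberg_spanP M0; apply/hessenberg_spanP.
have /is_trig_mxP tbV := upper_invmx ub tb; move/is_trig_mxP: tb => tb.
move=> i j le_ji; rewrite mxE big1 // => k _.
have [lt_jk|le_kj] := ltnP j k.
  by have := tb _ _ lt_jk; rewrite mxE => ->; rewrite mulr0.
rewrite mxE big1 ?mul0r // => l _.
have [lt_li|le_il] := ltnP l i.
  by have := tbV _ _ lt_li; rewrite mxE => ->; rewrite mul0r.
rewrite M0 ?mulr0 //; apply: leq_trans (h_mono _ _ le_kj) _.
exact: leq_trans le_il.
Qed.

(** * Points of the flag variety and their matrix representatives *)

Section FlagPoints.
Context (K : numFieldType).

Lemma borelM n (a b : 'M[K]_n) : borel a -> borel b -> borel (a *m b).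
Proof.
by move=> [ua ta] [ub tb]; split; [rewrite unitmx_mul ua|exact: upper_mulmx].
Qed.

Lemma borelV n (b : 'M[K]_n) : borel b -> borel (invmx b).
Proof. by move=> [ub tb]; split; [rewrite unitmx_inv|exact: upper_invmx]. Qed.

Lemma borel1 n : borel (1%:M : 'M[K]_n).
Proof. by split; [exact: unitmx1|rewrite trmx1 scalar_mx_is_trig]. Qed.

Definition GL_of n (g : 'M[K]_n) (ug : g \in unitmx) : GL K n :=
  exist _ g (mem_set ug).

(* Singular matrices are sent to the identity. *)
Definition mx_GL n (g : 'M[K]_n) : GL K n := insubd (GL_of (unitmx1 K n)) g.

Lemma mx_GLE n (g : 'M[K]_n) : g \in unitmx -> gl_mx (mx_GL g) = g.
Proof.
by move=> ug; rewrite /gl_mx set_valE /mx_GL val_insubd mem_set.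
Qed.

Lemma gl_mxP n (g : GL K n) : gl_mx g \in unitmx.
Proof. exact: set_mem (valP g). Qed.

Lemma gl_mx_inj n : injective (@gl_mx K n).
Proof. exact: val_inj. Qed.

Lemma flag_ofP n (g g' : GL K n) :
  flag_of g = flag_of g' <-> exists2 b, borel b & gl_mx g' = gl_mx g *m b.
Proof.
rewrite /flag_of; split=> [/eqmodP/asboolP gg'|[b Bb g'E]].
  have : borel_coset g' (gl_mx g').
    by exists 1%:M; [exact: borel1|rewrite mulmx1].
  by rewrite -gg' => -[b Bb <-]; exists b.
apply/eqmodP/asboolP/seteqP; split=> _ [c Bc <-].
  exists (invmx b *m c); first exact: borelM (borelV Bb) Bc.
  by rewrite g'E -mulmxA mulKVmx //; case: Bb.
exists (b *m c); first exact: borelM.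
by rewrite mulmxA -g'E.
Qed.

Lemma flag_ofK n (x : flag K n) : flag_of (repr x) = x.
Proof. exact: reprK. Qed.

(** As an image, [hess] only provides some representative satisfying the condition; invariance under
    conjugation by [B] passes it on to every representative. *)
Lemma hessP n (X : 'M[K]_n) (h : 'I_n -> nat) (g : GL K n) :
  hessenberg_fun h ->
  hess X (hessenberg_span K h) (flag_of g) <->
  invmx (gl_mx g) *m X *m gl_mx g \in hessenberg_span K h.
Proof.
move=> hh; split=> [[g' /= Hg' /flag_ofP[b Bb ->]]|Hg]; last by exists g.
have ub : b \in unitmx by case: Bb.
have -> : invmx (gl_mx g' *m b) = invmx b *m invmx (gl_mx g').
  apply: (can_inj (mulmxK (_ : gl_mx g' *m b \in unitmx))).
    by rewrite unitmx_mul gl_mxP.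
  rewrite mulVmx ?unitmx_mul ?gl_mxP // -mulmxA.
  rewrite [invmx _ *m (_ *m b)]mulKmx ?gl_mxP //.
  by rewrite mulVmx.
have := hessenberg_span_conj hh Bb Hg'.
by rewrite !mulmxA.
Qed.

Lemma hess_repr n (X : 'M[K]_n) (h : 'I_n -> nat) (x : flag K n) :
  hessenberg_fun h -> hess X (hessenberg_span K h) x ->
  invmx (gl_mx (repr x)) *m X *m gl_mx (repr x) \in hessenberg_span K h.
Proof. by move=> hh; rewrite -{1}[x]flag_ofK => /hessP; apply. Qed.

End FlagPoints.

(** * Topology of the flag variety *)

Section FlagTopology.
Context (K : numFieldType).

Lemma mx_continuous (T : topologicalType) m n (f : T -> 'M[K]_(m, n)) :
  (forall i j, continuous (fun x => f x i j)) -> continuous f.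
Proof.
move=> cf x A [P nbhsP sPA].
apply: (filterS (P := fun y => forall i j, P i j (f y i j))).
  by move=> y Py; exact: sPA.
apply: filter_forall => i; apply: filter_forall => j.
exact: cf.
Qed.

Lemma mulmxr_continuous n (b : 'M[K]_n) :
  continuous (fun g : 'M[K]_n => g *m b).
Proof.
apply: mx_continuous => i j.
rewrite (_ : (fun g : 'M[K]_n => _) =
  fun g : 'M[K]_n => \sum_k g i k * b k j); last first.
  by apply/funext => g; rewrite mxE.
apply: (@continuous_big K _ _ _ _ (@add_continuous K)) => k _ g.
apply: (continuous_comp (f := fun g : 'M[K]_n => g i k) (g := *%R^~ (b k j))).
  exact: coord_continuous.
exact: mulrr_continuous.
Qed.

Lemma ulsubmx_continuous m1 m2 :
  continuous (@ulsubmx K m1 m2 m1 m2).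
Proof.
apply: mx_continuous => i j.
rewrite (_ : (fun _ => _) =
  (fun M : 'M[K]_(m1 + m2) => M (lshift m2 i) (lshift m2 j))).
  exact: coord_continuous.
by apply/funext => M; rewrite mxE mxE.
Qed.

Lemma drsubmx_continuous m1 m2 :
  continuous (@drsubmx K m1 m2 m1 m2).
Proof.
apply: mx_continuous => i j.
rewrite (_ : (fun _ => _) =
  (fun M : 'M[K]_(m1 + m2) => M (rshift m1 i) (rshift m1 j))).
  exact: coord_continuous.
by apply/funext => M; rewrite mxE mxE.
Qed.

Lemma set_val_continuous (U : topologicalType) (A : set U) :
  continuous (set_val : set_type A -> U).
Proof. exact: initial_continuous. Qed.

Lemma gl_mx_continuous n : continuous (@gl_mx K n).
Proof. exact: set_val_continuous. Qed.

Lemma flag_of_continuous n : continuous (@flag_of K n).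
Proof. exact: pi_continuous. Qed.

(** The saturation of [U] is the union over [b] in [B] of the sets of [g] with [g b] in [U], each
    open because right multiplication by [b] is continuous. *)
Lemma flag_of_open n (U : set (GL K n)) : open U -> open (@flag_of K n @` U).
Proof.
move=> oU.
have cont (b : 'M[K]_n) : borel b ->
    continuous (fun g : GL K n => mx_GL (gl_mx g *m b)).
  move=> [ub _]; apply: continuous_comp_initial.
  rewrite (_ : _ \o _ = (fun g => g *m b) \o @gl_mx K n).
    move=> g; apply: continuous_comp; first exact: gl_mx_continuous.
    exact: mulmxr_continuous.
  apply/funext => g; rewrite -[LHS]/(gl_mx _) mx_GLE //.
  by rewrite unitmx_mul gl_mxP.
rewrite /open /= /quotient_open.
rewrite [X in open X](_ : _ = \bigcup_(b in borel (K := K) (n := n))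
  ((fun g : GL K n => mx_GL (gl_mx g *m b)) @^-1` U)).
  apply: bigcup_open => b Bb; move/continuousP: (cont b Bb); exact.
apply/seteqP; split=> [g [g' Ug'] /esym/flag_ofP[b Bb g'E]|g [b Bb /= Ugb]].
  exists b => //=; rewrite -g'E.
  by have -> : mx_GL (gl_mx g') = g' by apply: gl_mx_inj; rewrite mx_GLE ?gl_mxP.
exists (mx_GL (gl_mx g *m b)) => //; apply/esym/flag_ofP; exists b => //.
by rewrite mx_GLE // unitmx_mul gl_mxP; case: Bb.
Qed.
End FlagTopology.

(** * The regular nilpotent matrix: shifts, stable subspaces and rank *)

Section RegularNilpotent.
Context (K : numFieldType).

Lemma regular_nilpotentE n (i j : 'I_n) :
  regular_nilpotent n i j = (j == i.+1 :> nat)%:R :> K.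
Proof.
rewrite /regular_nilpotent summxE (bigD1 i) //=.
rewrite [X in _ + X]big1 => [|k ne_ki]; last first.
  by rewrite summxE big1 // => l _; rewrite mxE eq_sym (negPf ne_ki).
rewrite addr0 summxE big_mkcond (bigD1 j) //= [X in _ + X]big1 => [|l ne_lj].
  by case: eqP; rewrite ?mxE ?eqxx ?addr0.
by case: eqP => // _; rewrite mxE eqxx eq_sym (negPf ne_lj).
Qed.

(** Left multiplication by [N] moves every row up by one place. *)
Lemma iter_regular_nilpotent_mulmx n m p (Y : 'M[K]_(n, m)) (i k : 'I_n) j :
  (i + p)%N = k -> iter p (mulmx (regular_nilpotent n)) Y i j = Y k j.
Proof.
elim: p i => [|p IH] i ik.
  by congr (Y _ j); apply/val_inj; rewrite /= -ik addn0.
have lt_in : (i.+1 < n)%N.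
  by apply: leq_ltn_trans (ltn_ord k); rewrite -ik addnS ltnS leq_addr.
rewrite iterS mxE (bigD1 (Ordinal lt_in)) //= regular_nilpotentE eqxx mul1r.
rewrite big1 ?addr0 => [|l]; first by apply: IH; rewrite /= addSn -addnS.
by rewrite -val_eqE regular_nilpotentE => /negPf ->; rewrite mul0r.
Qed.

Lemma iter_regular_nilpotent_mulmx0 n m p (Y : 'M[K]_(n, m)) :
  (n <= p)%N -> iter p (mulmx (regular_nilpotent n)) Y = 0.
Proof.
move=> le_np; apply/matrixP => i j; rewrite mxE.
have {le_np} : (n <= i + p)%N by apply: leq_trans le_np (leq_addl _ _).
elim: p i => [|p IH] i le_n; first by move: le_n; rewrite addn0 leqNgt ltn_ord.
rewrite iterS mxE big1 // => l _; rewrite regular_nilpotentE.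
case: eqP => [li|]; last by rewrite mul0r.
by rewrite IH ?mulr0 // li addSn -addnS.
Qed.

(* The columns of Y span an N-stable subspace of dimension at most m, which
   therefore lies in the kernel of N^m. *)
Lemma regular_nilpotent_stable n m (Y : 'M[K]_(n, m)) (C : 'M[K]_m) :
  regular_nilpotent n *m Y = Y *m C ->
  forall (i : 'I_n) j, (m <= i)%N -> Y i j = 0.
Proof.
set N := regular_nilpotent n => NY i j le_mi.
pose Z p := iter p (mulmx N) Y.
have ZS p : Z p.+1 = Z p *m C.
  elim: p => // p IH; have -> : Z p.+2 = N *m Z p.+1 by [].
  by rewrite {1}IH mulmxA.
(* Right multiplication by [C] preserves inclusions of row spaces, so once the row spaces stop
   shrinking they never shrink again, while [N^n = 0]. *)
have Z_stab p : (Z p <= Z p.+1)%MS -> Z p = 0.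
  move=> le_Z; have le_ZS k : (Z (p + k)%N <= Z (p + k).+1)%MS.
    by elim: k => [|k IH]; rewrite ?addn0 // addnS !(ZS (p + _)%N) ZS submxMr // -ZS.
  have le_Zp k : (Z p <= Z (p + k)%N)%MS.
    elim: k => [|k IH]; first by rewrite addn0.
    by rewrite addnS; exact: submx_trans IH (le_ZS k).
  have := le_Zp n; rewrite {2}/Z iter_regular_nilpotent_mulmx0 ?leq_addl //.
  by move/submx0null.
(* Each step lowers the rank by at least one until [Z] vanishes, and the rank starts at [m] or
   less. *)
have rankZ p : Z p = 0 \/ (\rank (Z p) + p <= m)%N.
  elim: p => [|p [Z0|IH]]; first by right; rewrite addn0 rank_leq_col.
    by left; rewrite ZS Z0 mul0mx.
  have [/Z_stab Z0|nle_Z] := boolP (Z p <= Z p.+1)%MS.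
    by left; rewrite ZS Z0 mul0mx.
  right; rewrite addnS; apply: leq_trans IH; rewrite ltn_add2r.
  by apply: rank_ltmx; rewrite /ltmx nle_Z andbT submxMl.
have Zm : Z m = 0.
  have [//|] := rankZ m; rewrite -[X in (_ <= X)%N]add0n leq_add2r leqn0.
  by rewrite mxrank_eq0 => /eqP.
(* Row [i] of [Y] is row [i - m] of [Z m], which is zero. *)
have lt_n : (i - m < n)%N by apply: leq_ltn_trans (leq_subr _ _) (ltn_ord i).
rewrite -(@iter_regular_nilpotent_mulmx n _ m Y (Ordinal lt_n)) /= ?subnK //.
by rewrite -[iter _ _ _]/(Z m) Zm mxE.
Qed.

(** Adding [pid_mx 1], of rank at most one, to [N^T N] gives the identity. *)
Lemma rank_regular_nilpotent n : (n <= (\rank (regular_nilpotent n : 'M[K]_n)).+1)%N.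
Proof.
set N := regular_nilpotent n.
have NTN : N^T *m N + pid_mx 1 = 1%:M :> 'M[K]_n.
  apply/matrixP => i j; rewrite !mxE.
  have [i0|i_gt0] := posnP i.
    rewrite big1 => [|k _]; last first.
      by rewrite mxE regular_nilpotentE i0 /= mulr0n mul0r.
    by rewrite i0 add0r andbT -val_eqE /= i0.
  have lt_pn : (i.-1 < n)%N by apply: leq_ltn_trans (leq_pred _) (ltn_ord i).
  rewrite (bigD1 (Ordinal lt_pn)) //= big1 => [|k]; last first.
    rewrite -val_eqE /= => ne_k; rewrite mxE regular_nilpotentE.
    have [ik|_] := eqVneq (i : nat) k.+1; last by rewrite mul0r.
    by rewrite ik eqxx in ne_k.
  rewrite mxE !regular_nilpotentE /= prednK // eqxx mul1r addr0.
  by rewrite ltnNge i_gt0 andbF addr0 eq_sym.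
rewrite -{1}(mxrank1 K n) -NTN; apply: leq_trans (mxrank_add _ _) _.
rewrite -[X in (_ <= X)%N]addn1.
apply: leq_add; first exact: mxrankM_maxr.
case: n {N NTN} => [|n]; first by rewrite thinmx0 mxrank0.
by rewrite rank_pid_mx.
Qed.

Lemma mulmx_pid n b (M : 'M[K]_n) i j :
  (M *m pid_mx b) i j = M i j *+ (j < b)%N.
Proof.
rewrite mxE (bigD1 j) //= mxE eqxx /= big1 => [|k ne_kj].
  by rewrite addr0 mulr_natr.
by rewrite -val_eqE in ne_kj; rewrite mxE (negPf ne_kj) mulr0.
Qed.

Lemma pid_mulmx n a (M : 'M[K]_n) i j :
  (pid_mx a *m M) i j = M i j *+ (i < a)%N.
Proof.
rewrite mxE (bigD1 i) //= mxE eqxx /= big1 => [|k ne_ki].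
  by rewrite addr0 mulr_natl.
by rewrite eq_sym -val_eqE in ne_ki; rewrite mxE (negPf ne_ki) mul0r.
Qed.

(** The first [b] columns of [M] live in the first [a] rows and contribute rank at most [a]; the
    other columns contribute at most [n - b]. *)
Lemma rank_zero_corner n a b (M : 'M[K]_n) : (a <= n)%N -> (b <= n)%N ->
  (forall i j : 'I_n, (a <= i)%N -> (j < b)%N -> M i j = 0) ->
  (\rank M + b <= a + n)%N.
Proof.
move=> le_an le_bn M0.
have Ma : M *m pid_mx b = pid_mx a *m (M *m pid_mx b) :> 'M[K]_n.
  apply/matrixP => i j; rewrite pid_mulmx !mulmx_pid.
  have [lt_jb|] := ltnP j b; last by rewrite !mulr0n mul0rn.
  by have [//|le_ai] := ltnP i a; rewrite M0.
have {1}-> : M = (pid_mx a : 'M[K]_n) *m (M *m (pid_mx b : 'M[K]_n)) +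
    M *m copid_mx b.
  by rewrite -Ma -mulmxDr /copid_mx addrC subrK mulmx1.
rewrite -[X in (_ <= _ + X)%N](subnK le_bn) addnA leq_add2r.
apply: leq_trans (mxrank_add _ _) _; apply: leq_add.
  by apply: leq_trans (mxrankM_maxl _ _) _; rewrite rank_pid_mx.
by apply: leq_trans (mxrankM_maxr _ _) _; rewrite rank_copid_mx.
Qed.
End RegularNilpotent.

(** * Conjugating the regular nilpotent by block upper triangular matrices *)

Section BlockConjugation.
Context (K : numFieldType) (n1 n2 : nat).
Local Notation N := (@regular_nilpotent K (n1 + n2)).

Lemma unitmx_ublock (A : 'M[K]_n1) (C : 'M[K]_(n1, n2)) (D : 'M[K]_n2) :
  block_mx A C 0 D \in unitmx = (A \in unitmx) && (D \in unitmx).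
Proof. by rewrite !unitmxE det_ublock unitrM. Qed.

Lemma regular_nilpotent_block :
  N = block_mx (regular_nilpotent n1) (ursubmx N) 0 (regular_nilpotent n2).
Proof.
rewrite -[LHS]submxK; congr block_mx; apply/matrixP => i j;
  rewrite ?mxE !regular_nilpotentE //=.
  rewrite ltn_eqF //; apply: leq_trans (ltn_ord j) _.
  by rewrite -addnS leq_addr.
by rewrite -addnS eqn_add2l.
Qed.

(** The blocks are read off from [g M = N g], which avoids a block formula for the inverse of [g].
    The corner [E] stays unspecified because, under [h_dr], the Hessenberg condition does not
    constrain it. *)
Lemma conj_regular_nilpotent_block (A : 'M[K]_n1) (C : 'M[K]_(n1, n2))
    (D : 'M[K]_n2) (g := block_mx A C 0 D) : g \in unitmx ->
  exists E, invmx g *m N *m g =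
    block_mx (invmx A *m regular_nilpotent n1 *m A) E
             0 (invmx D *m regular_nilpotent n2 *m D).
Proof.
move=> ug; have /andP[uA uD] : (A \in unitmx) && (D \in unitmx).
  by rewrite -(unitmx_ublock _ C).
set M := invmx g *m N *m g; exists (ursubmx M).
have : g *m M = N *m g by rewrite /M -mulmxA mulKVmx.
rewrite -{1}[M]submxK /g [in RHS]regular_nilpotent_block !mulmx_block.
rewrite !mul0mx !mulmx0 !add0r !addr0 => /eq_block_mx[+ _ + DE].
move=> + /(congr1 (mulmx (invmx D))); rewrite mulmx0 mulKmx // => AE M21.
rewrite M21 mulmx0 addr0 in AE.
rewrite -[LHS]submxK M21 -!mulmxA -AE -DE !mulKmx //.
Qed.

Context (h : 'I_(n1 + n2) -> nat) (hh : hessenberg_fun h).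

Definition hessenberg_ul (i : 'I_n1) : nat := h (lshift n2 i).
(** Rows of the lower block are counted from [n1], hence the shift; [h_dr] makes the truncated
    subtraction exact. *)
Definition hessenberg_dr (i : 'I_n2) : nat := (h (rshift n1 i) - n1)%N.

Hypothesis h_ul : forall i : 'I_n1, (h (lshift n2 i) <= n1)%N.
Hypothesis h_dr : forall i : 'I_n2, (n1 <= h (rshift n1 i))%N.

Lemma hessenberg_fun_ul : hessenberg_fun hessenberg_ul.
Proof. by split=> [i|i j le_ij]; [exact: h_ul|exact: hh.2]. Qed.

Lemma hessenberg_fun_dr : hessenberg_fun hessenberg_dr.
Proof.
split=> [i|i j le_ij]; first by rewrite leq_subLR; exact: hh.1.
by apply/leq_sub2r/hh.2; rewrite leq_add2l.
Qed.

Lemma hessenberg_span_block (A : 'M[K]_n1) C (D : 'M[K]_n2) :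
  block_mx A C 0 D \in hessenberg_span K h <->
  A \in hessenberg_span K hessenberg_ul /\ D \in hessenberg_span K hessenberg_dr.
Proof.
split=> [/hessenberg_spanP M0|[/hessenberg_spanP A0 /hessenberg_spanP D0]].
  split; apply/hessenberg_spanP => i j le_ji.
    by have := M0 (lshift n2 i) (lshift n2 j) le_ji; rewrite block_mxEul.
  have := M0 (rshift n1 i) (rshift n1 j); rewrite block_mxEdr; apply.
  by rewrite /= -leq_subLR.
apply/hessenberg_spanP => i j.
case: (split_ordP i) => {}i ->; case: (split_ordP j) => {}j -> /= le_ji.
- by rewrite block_mxEul A0.
- by have := leq_trans (h_dr j) le_ji; rewrite leqNgt ltn_ord.
- by rewrite block_mxEdl mxE.
- by rewrite block_mxEdr D0 // leq_subLR.
Qed.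

Lemma conj_hessenberg_block (A : 'M[K]_n1) (C : 'M[K]_(n1, n2))
    (D : 'M[K]_n2) (g := block_mx A C 0 D) : g \in unitmx ->
  invmx g *m N *m g \in hessenberg_span K h <->
  invmx A *m regular_nilpotent n1 *m A \in hessenberg_span K hessenberg_ul /\
  invmx D *m regular_nilpotent n2 *m D \in hessenberg_span K hessenberg_dr.
Proof.
move=> ug; have [E ->] := conj_regular_nilpotent_block ug.
exact: hessenberg_span_block.
Qed.

(** By [h_ul] the first [n1] columns of [g] span an [N]-stable subspace, and
    [regular_nilpotent_stable] forces it into the span of the first [n1] basis vectors. *)
Lemma conj_hessenberg_dlsubmx (g : 'M[K]_(n1 + n2)) : g \in unitmx ->
  invmx g *m N *m g \in hessenberg_span K h -> dlsubmx g = 0.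
Proof.
move=> ug; set M := _ *m g => /hessenberg_spanP M0.
have M21 : dlsubmx M = 0.
  apply/matrixP => i j; rewrite mxE mxE [RHS]mxE; apply: M0.
  exact: leq_trans (h_ul j) (leq_addr _ _).
have gM : N *m lsubmx g = lsubmx g *m ulsubmx M.
  have -> : N *m lsubmx g = lsubmx (N *m g).
    by rewrite -{2}[g]hsubmxK mul_mx_row row_mxKl.
  have -> : N *m g = g *m M by rewrite /M -mulmxA mulKVmx.
  rewrite -{1}[g]hsubmxK -[M in LHS]submxK M21.
  by rewrite mul_row_block mulmx0 addr0 row_mxKl.
apply/matrixP => i j; rewrite mxE; have := regular_nilpotent_stable gM.
by move=> /(_ (rshift n1 i) j); rewrite !mxE; apply; exact: leq_addr.
Qed.

End BlockConjugation.

(** Conjugation keeps the rank of [N], which is at least [n - 1]. By monotonicity the first [n1 + 1]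
    columns of the conjugate would vanish from row [h (rshift n1 i0)] on, and this value is at most
    [n1 - 1], so the rank would be at most [n - 2]. *)
Lemma hess_empty (K : numFieldType) n1 n2 (h : 'I_(n1 + n2) -> nat)
    (i0 : 'I_n2) :
  hessenberg_fun h -> (i0 = 0 :> nat)%N -> (h (rshift n1 i0) < n1)%N ->
  hess (regular_nilpotent (n1 + n2)) (hessenberg_span K h) = set0.
Proof.
move=> hh i00 lt_h; apply/seteqP; split=> // _ [g /= /hessenberg_spanP M0 _].
set M := _ *m gl_mx g in M0; set n := (n1 + n2)%N in g M M0 *.
have rankM : \rank M = \rank (regular_nilpotent n : 'M[K]_n).
  have ug := gl_mxP g; rewrite /M mxrankMfree ?row_free_unit //.
  by rewrite eqmxMfull // row_full_unit unitmx_inv.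
have lt_n1 : (n1 < n)%N.
  by rewrite -[X in (X < _)%N]addn0 ltn_add2l (leq_ltn_trans _ (ltn_ord i0)).
have : (\rank M + n1.+1 <= h (rshift n1 i0) + n)%N.
  apply: rank_zero_corner; [exact: hh.1|exact: lt_n1|move=> i j le_hi le_jn1].
  apply: M0; apply: leq_trans le_hi; apply: hh.2.
  by rewrite /= i00 addn0.
rewrite rankM -addSnnS leqNgt => /negP; apply.
rewrite [X in (_ < X)%N]addnC.
exact: leq_add lt_h (rank_regular_nilpotent K n).
Qed.

(** * Restricting flags to diagonal blocks, gluing them, and continuity *)

Section FlagMaps.
Context (K : numFieldType).

Lemma flag_of_nbhs n (g : GL K n) (P : set (GL K n)) :
  nbhs g P -> nbhs (flag_of g) (@flag_of K n @` P).
Proof.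
rewrite nbhsE => -[Q [oQ Qg] sQP]; rewrite nbhsE.
exists (@flag_of K n @` Q); last exact: image_subset.
by split; [exact: flag_of_open|exists g].
Qed.

(* A map on representatives that lands in GL over V only descends to a
   continuous map on V, because flag_of is open. *)
Lemma flag_map_continuous n m (V : set (flag K n)) (s : 'M[K]_n -> 'M[K]_m)
    (psi : flag K n -> flag K m) :
  continuous s ->
  (forall g, V (flag_of g) -> s (gl_mx g) \in unitmx) ->
  (forall g, V (flag_of g) -> psi (flag_of g) = flag_of (mx_GL (s (gl_mx g)))) ->
  continuous (fun v : set_type V => psi (set_val v)).
Proof.
move=> cs us psiE v O.
set g := repr (set_val v).
have Vg : V (flag_of g) by rewrite flag_ofK; exact: set_mem (valP v).
have vE : set_val v = flag_of g by rewrite flag_ofK.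
rewrite vE psiE // => /flag_of_continuous [_ [[B oB <-] /= Bg sBO]].
have {}Bg : B (s (gl_mx g)) by move: Bg; rewrite -[set_val _]/(gl_mx _) mx_GLE ?us.
have Pg : nbhs g [set g' | B (s (gl_mx g'))].
  have /(_ B) : {for g, continuous (s \o @gl_mx K n)}.
    by apply: continuous_comp; [exact: gl_mx_continuous|exact: cs].
  by apply; apply: open_nbhs_nbhs.
have := flag_of_nbhs Pg; rewrite -vE => nPg.
have {}nPg : nbhs v [set w : set_type V |
    (@flag_of K n @` [set g' | B (s (gl_mx g'))]) (set_val w)].
  exact: (@set_val_continuous _ V v _ nPg).
suff : nbhs v [set w : set_type V | O (psi (set_val w))] by [].
apply: filterS nPg => w /= [g' Bg' g'w]; have Vg' : V (flag_of g').
  by rewrite g'w; exact: set_mem (valP w).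
rewrite -g'w psiE //; apply: sBO => /=.
by rewrite -[set_val _]/(gl_mx _) mx_GLE ?us.
Qed.

(** A product of quotient maps need not be a quotient map; here both projections are open, so
    neighbourhoods of representatives map to neighbourhoods of the flags. *)
Lemma flag_map2_continuous n1 n2 n (F : GL K n1 * GL K n2 -> GL K n)
    (phi : flag K n1 * flag K n2 -> flag K n) :
  continuous F ->
  (forall p, phi (flag_of p.1, flag_of p.2) = flag_of (F p)) ->
  continuous phi.
Proof.
move=> cF phiE [x y] O.
rewrite -[x]flag_ofK -[y]flag_ofK (phiE (repr x, repr y)).
move=> /flag_of_continuous /cF [[P Q] /= [nP nQ] sPQ].
exists (@flag_of K n1 @` P, @flag_of K n2 @` Q) => /=.
  by split; exact: flag_of_nbhs.
move=> [_ _] [/= [a Pa <-] [d Qd <-]].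
by rewrite /= (phiE (a, d)); exact: (sPQ (a, d)).
Qed.

Context (n1 n2 : nat).

Lemma borel_block_mx (a : 'M[K]_n1) (d : 'M[K]_n2) :
  borel a -> borel d -> borel (block_mx a 0 0 d).
Proof.
move=> [ua ta] [ud td]; split; first by rewrite /= unitmx_ublock ua.
by rewrite tr_block_mx !trmx0 is_trig_block_mx // eqxx ta.
Qed.

Lemma unitmx_block_dl0 (g : 'M[K]_(n1 + n2)) : g \in unitmx ->
  dlsubmx g = 0 -> ulsubmx g \in unitmx /\ drsubmx g \in unitmx.
Proof.
move=> ug g0; move: ug; rewrite -[g]submxK g0 unitmx_ublock => /andP[].
by rewrite block_mxKul block_mxKdr.
Qed.

Lemma borel_submx (b : 'M[K]_(n1 + n2)) : borel b ->
  [/\ borel (ulsubmx b), borel (drsubmx b) & dlsubmx b = 0].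
Proof.
move=> [ub tb].
have dl0 : dlsubmx b = 0.
  by apply: trmx_inj; rewrite trmx_dlsub trmx0; exact: ursubmx_trig.
have : is_trig_mx (block_mx (ulsubmx b)^T 0 (ursubmx b)^T (drsubmx b)^T).
  by rewrite -[X in block_mx _ X]trmx0 -dl0 -tr_block_mx submxK.
rewrite is_trig_block_mx // => /and3P[_ tul tdr].
have [uul udr] := unitmx_block_dl0 ub dl0.
by split; [split|split|].
Qed.

(** The flag [x.1] in the first [n1] coordinates, continued by adding the flag [x.2] of the last
    [n2] coordinates. *)
Definition flag_sum (x : flag K n1 * flag K n2) : flag K (n1 + n2) :=
  flag_of (mx_GL (block_mx (gl_mx (repr x.1)) 0 0 (gl_mx (repr x.2)))).

(** Another choice of representatives multiplies the block diagonal matrix on the right by a block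
    diagonal element of [B]. *)
Lemma flag_sumE (p : GL K n1 * GL K n2) :
  flag_sum (flag_of p.1, flag_of p.2) =
  flag_of (mx_GL (block_mx (gl_mx p.1) 0 0 (gl_mx p.2))).
Proof.
case: p => a d; rewrite /flag_sum /=; apply/esym/flag_ofP.
have /esym/flag_ofP[b Bb ->] := flag_ofK (flag_of a).
have /esym/flag_ofP[c Bc ->] := flag_ofK (flag_of d).
exists (block_mx b 0 0 c); first exact: borel_block_mx.
have [ub uc] : b \in unitmx /\ c \in unitmx by case: Bb; case: Bc.
rewrite !mx_GLE ?unitmx_ublock ?unitmx_mul ?gl_mxP ?ub ?uc //.
by rewrite mulmx_block !mulmx0 !mul0mx !addr0 add0r.
Qed.

Lemma flag_sum_continuous : continuous flag_sum.
Proof.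
apply: flag_map2_continuous flag_sumE.
apply: continuous_comp_initial.
rewrite (_ : _ \o _ = fun p => block_mx (gl_mx p.1) 0 0 (gl_mx p.2)); last first.
  apply/funext => p /=; rewrite -[LHS]/(gl_mx _) mx_GLE //.
  by rewrite unitmx_ublock !gl_mxP.
apply: mx_continuous => i j.
have coordC m (k l : 'I_m) : continuous (fun a : GL K m => gl_mx a k l).
  move=> a; apply: (continuous_comp (g := fun M : 'M[K]_m => M k l)).
    exact: gl_mx_continuous.
  exact: coord_continuous.
case: (split_ordP i) => {}i ->; case: (split_ordP j) => {}j ->.
- rewrite (_ : (fun _ => _) = (fun a => gl_mx a i j) \o fst); last first.
    by apply/funext => p; rewrite /= block_mxEul.
  by move=> p; apply: continuous_comp; [exact: cvg_fst|exact: coordC].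
- rewrite (_ : (fun _ => _) = cst 0); first exact: cst_continuous.
  by apply/funext => p; rewrite block_mxEur mxE.
- rewrite (_ : (fun _ => _) = cst 0); first exact: cst_continuous.
  by apply/funext => p; rewrite block_mxEdl mxE.
- rewrite (_ : (fun _ => _) = (fun a => gl_mx a i j) \o snd); last first.
    by apply/funext => p; rewrite /= block_mxEdr.
  by move=> p; apply: continuous_comp; [exact: cvg_snd|exact: coordC].
Qed.

(** If the [n1]-dimensional member of the flag is the span of the first [n1] basis vectors, this is
    the induced flag on that subspace, and [flag_dr] is the one on the quotient. On other flags the
    values may depend on the chosen representative. *)
Definition flag_ul (x : flag K (n1 + n2)) : flag K n1 :=
  flag_of (mx_GL (ulsubmx (gl_mx (repr x)))).

Definition flag_dr (x : flag K (n1 + n2)) : flag K n2 :=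
  flag_of (mx_GL (drsubmx (gl_mx (repr x)))).

(** With vanishing lower left blocks, taking the upper left block is multiplicative, so a factor in
    [B] restricts to a factor in the smaller Borel subgroup. *)
Lemma flag_ulE (g : GL K (n1 + n2)) : dlsubmx (gl_mx g) = 0 ->
  flag_ul (flag_of g) = flag_of (mx_GL (ulsubmx (gl_mx g))).
Proof.
move=> g0; apply/esym/flag_ofP.
have /esym/flag_ofP[b Bb ->] := flag_ofK (flag_of g).
have [Bul _ b0] := borel_submx Bb; exists (ulsubmx b) => //.
have [uul _] := unitmx_block_dl0 (gl_mxP g) g0.
have -> : ulsubmx (gl_mx g *m b) = ulsubmx (gl_mx g) *m ulsubmx b.
  rewrite -{1}[gl_mx g]submxK -{1}[b]submxK g0 b0 mulmx_block block_mxKul.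
  by rewrite mulmx0 addr0.
by rewrite !mx_GLE ?unitmx_mul ?uul //; case: Bul.
Qed.

Lemma flag_drE (g : GL K (n1 + n2)) : dlsubmx (gl_mx g) = 0 ->
  flag_dr (flag_of g) = flag_of (mx_GL (drsubmx (gl_mx g))).
Proof.
move=> g0; apply/esym/flag_ofP.
have /esym/flag_ofP[b Bb ->] := flag_ofK (flag_of g).
have [_ Bdr b0] := borel_submx Bb; exists (drsubmx b) => //.
have [_ udr] := unitmx_block_dl0 (gl_mxP g) g0.
have -> : drsubmx (gl_mx g *m b) = drsubmx (gl_mx g) *m drsubmx b.
  rewrite -{1}[gl_mx g]submxK -{1}[b]submxK g0 b0 mulmx_block block_mxKdr.
  by rewrite mul0mx add0r.
by rewrite !mx_GLE ?unitmx_mul ?udr //; case: Bdr.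
Qed.

End FlagMaps.

(** * Splitting a Hessenberg variety as a product *)

Section Decomposition.
Context (K : numFieldType).

(** The inverse maps are [(flag_ul, flag_dr)] and [flag_sum]. The bound on the first [n1] columns
    makes every representative block upper triangular; the bound on the others lets the Hessenberg
    condition split over the diagonal blocks. *)
Lemma hess_block_homeomorphic n1 n2 (h : 'I_(n1 + n2) -> nat) :
  hessenberg_fun h ->
  (forall i : 'I_n1, (h (lshift n2 i) <= n1)%N) ->
  (forall i : 'I_n2, (n1 <= h (rshift n1 i))%N) ->
  homeomorphic
    (set_type (hess (regular_nilpotent (n1 + n2)) (hessenberg_span K h)))
    (set_type (hess (regular_nilpotent n1)
                    (hessenberg_span K (hessenberg_ul h))) *
     set_type (hess (regular_nilpotent n2)
                    (hessenberg_span K (hessenberg_dr h))))%type.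
Proof.
move=> hh h_ul h_dr.
set V := hess _ (hessenberg_span K h).
set V1 := hess (regular_nilpotent n1) _; set V2 := hess (regular_nilpotent n2) _.
have hh1 := hessenberg_fun_ul hh h_ul; have hh2 := hessenberg_fun_dr hh.
have V_dl g : V (flag_of g) -> dlsubmx (gl_mx g) = 0.
  by move/hessP => /(_ hh); exact/conj_hessenberg_dlsubmx/gl_mxP.
have V_unit g : V (flag_of g) ->
    ulsubmx (gl_mx g) \in unitmx /\ drsubmx (gl_mx g) \in unitmx.
  by move/V_dl; exact/unitmx_block_dl0/gl_mxP.
have flag_ofE m (x : flag K m) : exists g, x = flag_of g.
  by exists (repr x); rewrite flag_ofK.
have V_block g : V (flag_of g) -> gl_mx g =
    block_mx (ulsubmx (gl_mx g)) (ursubmx (gl_mx g)) 0 (drsubmx (gl_mx g)).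
  by move=> Vg; rewrite -(V_dl _ Vg) submxK.
have V_sub x : V x -> V1 (flag_ul x) /\ V2 (flag_dr x).
  have [g ->] := flag_ofE _ x => Vg.
  have [ug dg] := V_unit g Vg; rewrite flag_ulE ?flag_drE ?V_dl //.
  have ub := gl_mxP g; rewrite (V_block _ Vg) in ub.
  move/hessP: (Vg) => /(_ hh); rewrite {1 2}(V_block _ Vg).
  move=> /(conj_hessenberg_block h_dr ub)[H1g H2g].
  by split; apply/hessP; rewrite ?mx_GLE.
have V_sum x : V1 x.1 -> V2 x.2 -> V (flag_sum x).
  move=> /hess_repr => /(_ hh1) V1x /hess_repr => /(_ hh2) V2x.
  have uxx : block_mx (gl_mx (repr x.1)) 0 0 (gl_mx (repr x.2)) \in unitmx.
    by rewrite unitmx_ublock !gl_mxP.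
  apply/hessP => //; rewrite mx_GLE //.
  by apply/(conj_hessenberg_block h_dr uxx).
have ul_sum (x : flag K n1 * flag K n2) : flag_ul (flag_sum x) = x.1.
  case: x => x y; have [[a ->] [d ->]] := (flag_ofE _ x, flag_ofE _ y).
  have uad : block_mx (gl_mx a) 0 0 (gl_mx d) \in unitmx.
    by rewrite unitmx_ublock !gl_mxP.
  rewrite (flag_sumE (a, d)) /= flag_ulE mx_GLE // ?block_mxKdl // block_mxKul.
  by congr flag_of; apply: gl_mx_inj; rewrite mx_GLE ?gl_mxP.
have dr_sum (x : flag K n1 * flag K n2) : flag_dr (flag_sum x) = x.2.
  case: x => x y; have [[a ->] [d ->]] := (flag_ofE _ x, flag_ofE _ y).
  have uad : block_mx (gl_mx a) 0 0 (gl_mx d) \in unitmx.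
    by rewrite unitmx_ublock !gl_mxP.
  rewrite (flag_sumE (a, d)) /= flag_drE mx_GLE // ?block_mxKdl // block_mxKdr.
  by congr flag_of; apply: gl_mx_inj; rewrite mx_GLE ?gl_mxP.
have sum_sub x : V x -> flag_sum (flag_ul x, flag_dr x) = x.
  have [g ->] := flag_ofE _ x => Vg.
  have [ug dg] := V_unit g Vg; rewrite flag_ulE ?flag_drE ?V_dl //.
  set A := ulsubmx _ in ug *; set D := drsubmx _ in dg *.
  rewrite (flag_sumE (mx_GL A, mx_GL D)) /= !mx_GLE //.
  (* With [C] the upper right block, [[A C; 0 D]] is [diag(A, D)] times [[1 A^-1 C; 0 1]], and the
     last factor lies in [B]. *)
  apply/flag_ofP; exists (block_mx 1%:M (invmx A *m ursubmx (gl_mx g)) 0 1%:M).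
    split; first by rewrite /= unitmx_ublock !unitmx1.
    by rewrite tr_block_mx trmx0 is_trig_block_mx // !trmx1 !scalar_mx_is_trig eqxx.
  rewrite mx_GLE ?unitmx_ublock ?ug // mulmx_block.
  by rewrite !mulmx0 !mul0mx !mulmx1 !addr0 add0r mulKVmx // -V_block.
pose f (v : set_type V) : set_type V1 * set_type V2 :=
  (exist _ (flag_ul (set_val v)) (mem_set (V_sub _ (set_mem (valP v))).1),
   exist _ (flag_dr (set_val v)) (mem_set (V_sub _ (set_mem (valP v))).2)).
pose g (w : set_type V1 * set_type V2) : set_type V :=
  exist _ (flag_sum (set_val w.1, set_val w.2))
    (mem_set (V_sum (set_val w.1, set_val w.2)
      (set_mem (valP w.1)) (set_mem (valP w.2)))).
exists f, g; split.
- by move=> v; apply/val_inj; rewrite /= sum_sub //; exact: set_mem (valP v).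
- by move=> [v w]; congr pair; apply/val_inj; rewrite /= ?ul_sum ?dr_sum.
- have cf1 : continuous (fun v => (f v).1).
    apply: continuous_comp_initial.
    apply: (flag_map_continuous (s := ulsubmx)) => [|g' /V_unit[]|g' /V_dl] //.
      exact: ulsubmx_continuous.
    exact: flag_ulE.
  have cf2 : continuous (fun v => (f v).2).
    apply: continuous_comp_initial.
    apply: (flag_map_continuous (s := drsubmx)) => [|g' /V_unit[]|g' /V_dl] //.
      exact: drsubmx_continuous.
    exact: flag_drE.
  by move=> v; exact: (cvg_pair (cf1 v) (cf2 v)).
- apply: continuous_comp_initial => w.
  have c1 : continuous (fun w : set_type V1 * set_type V2 => set_val w.1).
    by move=> u; apply: continuous_comp; [exact: cvg_fst|exact: set_val_continuous].
  have c2 : continuous (fun w : set_type V1 * set_type V2 => set_val w.2).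
    by move=> u; apply: continuous_comp; [exact: cvg_snd|exact: set_val_continuous].
  apply: (continuous_comp (f := fun w : set_type V1 * set_type V2 =>
    (set_val w.1, set_val w.2)) (g := @flag_sum K n1 n2)).
    exact: (cvg_pair (c1 w) (c2 w)).
  exact: flag_sum_continuous.
Qed.

Lemma decomposable_set0 n : (1 < n)%N -> decomposable (set0 : set (flag K n)).
Proof.
(* In [gl_1] no conjugate of the identity lies in the zero Hessenberg space, which gives an empty
   factor. *)
move=> n_gt1; pose Z := hessenberg_span K (fun _ : 'I_1 => 0%N).
have hZ : hessenberg_space Z by exists (fun=> 0%N).
have Z0 : hess 1%:M Z = set0.
  apply/seteqP; split=> // _ [g /= /hessenberg_spanP M0 _].
  have := M0 ord0 ord0 (leqnn _); rewrite mulmx1 mulVmx ?gl_mxP // mxE eqxx.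
  by move/eqP; rewrite oner_eq0.
exists 1%N, 1%N, 1%:M, 1%:M, Z, Z; split=> //; rewrite Z0.
have no T (v : set_type (set0 : set T)) : False by exact: set_mem (valP v).
exists (fun v => match no _ v with end), (fun w => match no _ w.1 with end).
by split=> [v|w|v|w]; case: (no _ v) || case: (no _ w.1).
Qed.

(** The first column of the lower block decides: a value of [h] below [n1] empties the variety;
    otherwise monotonicity gives the bound needed for the splitting. *)
Lemma decomposable_hess n1 n2 (h : 'I_(n1 + n2) -> nat) :
  hessenberg_fun h -> (0 < n1)%N -> (0 < n2)%N ->
  (forall i : 'I_(n1 + n2), (i < n1)%N -> (h i <= n1)%N) ->
  decomposable (hess (regular_nilpotent (n1 + n2)) (hessenberg_span K h)).
Proof.
move=> hh n1_gt0 n2_gt0 h1.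
have h_ul (i : 'I_n1) : (h (lshift n2 i) <= n1)%N by apply: h1 => /=.
have [h_lt|h_ge] := ltnP (h (rshift n1 (Ordinal n2_gt0))) n1.
  rewrite (hess_empty K hh _ h_lt) //; apply: decomposable_set0.
  exact: leq_add n1_gt0 n2_gt0.
have h_dr (i : 'I_n2) : (n1 <= h (rshift n1 i))%N.
  by apply: leq_trans h_ge (hh.2 _ _ _); rewrite /= addn0 leq_addr.
exists n1, n2, (regular_nilpotent n1), (regular_nilpotent n2).
exists (hessenberg_span K (hessenberg_ul h)), (hessenberg_span K (hessenberg_dr h)).
split.
- by rewrite n1_gt0 -[X in (X < _)%N]addn0 ltn_add2l.
- by rewrite n2_gt0 -[X in (X < _)%N]add0n ltn_add2r.
- by exists (hessenberg_ul h) => //; exact: hessenberg_fun_ul.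
- by exists (hessenberg_dr h) => //; exact: hessenberg_fun_dr.
- exact: hess_block_homeomorphic.
Qed.

(** * Comparison with the Peterson variety *)

Lemma hessenberg_fun_peterson n : hessenberg_fun (@peterson_fun n).
Proof.
rewrite /peterson_fun; split=> [i|i j le_ij]; first by case: ifP.
case: (ltnP i.+1 n) => [lt_in|le_ni]; case: (ltnP j.+1 n) => //= _.
by apply: leq_trans le_ni _; rewrite ltnS leqW.
Qed.

Lemma hess_subset n (X : 'M[K]_n) (H1 H2 : {vspace 'M[K]_n}) :
  (H1 <= H2)%VS -> hess X H1 `<=` hess X H2.
Proof. by move=> /subvP sH _ [g /= Hg <-]; exists g => //=; exact: sH. Qed.
End Decomposition.

Theorem proposition21 (R : realType) (n : nat) (n_ge1 : (1 <= n)%N) :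
  let N : 'M[R[i]]_n := regular_nilpotent n in
  [/\ hessenberg_space (peterson_space n : {vspace 'M[R[i]]_n}),
      hessenberg_space (fullv : {vspace 'M[R[i]]_n}),
      hess N fullv = [set: flag R[i] n] &
      forall H : {vspace 'M[R[i]]_n},
        hessenberg_space H -> ~ decomposable (hess N H) ->
        hess N (peterson_space n) `<=` hess N H /\
        hess N H `<=` hess N fullv].
Proof.
move=> N; split.
- by exists (@peterson_fun n) => //; exact: hessenberg_fun_peterson.
- exists (fun=> n) => //; apply/eqP; rewrite eqEsubv subvf andbT; apply/subvP => M _.
  by apply/hessenberg_spanP => i j; rewrite leqNgt ltn_ord.
- apply/seteqP; split=> // x _; exists (repr x); last exact: flag_ofK.
  exact: memvf.
move=> H [h hh HE] indec; split; last exact/hess_subset/subvf.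
(* If the bound fails at [i], then [h] is at most [i + 1] on the first [i + 1] columns, and the
   variety splits at [n1 = i + 1]. *)
have h_ge (i : 'I_n) : (i.+1 < n)%N -> (i.+2 <= h i)%N.
  move=> lt_in; rewrite ltnNge; apply/negP => le_hi; apply: indec.
  rewrite /N HE; have [n2 nE] : exists n2, n = (i.+1 + n2)%N.
    by exists (n - i.+1)%N; rewrite subnKC.
  have h_lt (j : 'I_n) : (j < i.+1)%N -> (h j <= i.+1)%N.
    by move=> le_ji; apply: leq_trans le_hi; exact: hh.2.
  (* The type of [i] mentions [n], so [i.+1] is generalized before [n] is replaced by [n1 + n2]. *)
  move: (i.+1) (ltn0Sn i) lt_in h_lt nE => n1 n1_gt0 lt_n1 h_lt nE.
  subst n; apply: decomposable_hess => //.
  by rewrite -(ltn_add2l n1) addn0.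
(* For [n = 1] the space [H] may be zero, so the spaces need not be nested; but then [N = 0] and
   every Hessenberg variety of [N] is the whole flag variety. *)
rewrite HE; have [n_le1|n_gt1] := leqP n 1.
  have N0 : N = 0.
    apply/matrixP => i j; rewrite regular_nilpotentE mxE ltn_eqF //.
    exact: leq_trans (ltn_ord j) (leq_trans n_le1 _).
  by move=> _ [g _ <-]; exists g => //=; rewrite N0 mulmx0 mul0mx mem0v.
apply/hess_subset/subvP => M /hessenberg_spanP M0; apply/hessenberg_spanP.
move=> i j le_hi; apply: M0; apply: leq_trans le_hi; rewrite /peterson_fun.
case: ltnP => [|le_nj]; first exact: h_ge.
(* In the last column the required bound [n] comes by monotonicity from the column before it, which
   exists since [n > 1]. *)
have lt_j1 : (j.-1.+1 < n)%N.
  by case: (nat_of_ord j) (ltn_ord j) => [|k].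
have lt_j1n := ltnW lt_j1.
apply: leq_trans (hh.2 (Ordinal lt_j1n) j (leq_pred _)).
apply: leq_trans (h_ge (Ordinal lt_j1n) lt_j1) => /=.
by apply: leq_trans le_nj _; rewrite ltnS leqSpred.
Qed.
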